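(* Let $G$ be a group, let $g,h\in G$, and suppose that $G$ has a $(g,h)$-wS-subset. Then the subgroup $H=\langle g,h\rangle$ of $G$ is either free over $(g,h)$, or there exists an integer $k\ge 2$ such that $H$ has the presentation $H=G_k=\langle g,h\mid (h^{-1}g)^k\rangle$ (with respect to the generators $g,h$).
   Context: For a group $G$ and $g,h\in G$, a subset $E\subseteq G$ is a $(g,h)$-wS-subset (weak Sierpiński subset with respect to $g$ and $h$) if there exist elements $a\neq b$ in $E$ such that $gE=E\smallsetminus\{a\}$ and $hE=E\smallsetminus\{b\}$, where $gE=\{gx: x\in E\}$. ''$H$ is free over $(g,h)$'' means that the homomorphism from the free group on two letters $x,y$ to $H$ sending $x\mapsto g$, $y\mapsto h$ is an isomorphism. ''$H$ has the presentation $\langle g,h\mid (h^{-1}g)^k\rangle$'' means that the kernel of this homomorphism is the normal closure of $(y^{-1}x)^k$. *)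

(* Defs.v *)
From HB Require Import structures.
From mathcomp Require Import all_boot.
From mathcomp Require Import boolp classical_sets.

Set Implicit Arguments.
Unset Strict Implicit.
Unset Printing Implicit Defensive.

Local Open Scope classical_set_scope.
Local Open Scope group_scope.

(* Subsets of a group are taken in [set G] (that is, [G -> Prop]). *)

Definition wS_subset (G : groupType) (g h : G) (E : set G) : Prop :=
  exists a b : G, [/\ E a, E b, a <> b,
    [set g * x | x in E] = E `\ a & [set h * x | x in E] = E `\ b].

Definition is_subgroup (G : groupType) (S : set G) : Prop :=
  [/\ S 1, (forall x y, S x -> S y -> S (x * y)) & (forall x, S x -> S x^-1)].

Definition is_normal_subgroup (G : groupType) (S : set G) : Prop :=
  is_subgroup S /\ (forall x y, S x -> S (x ^ y)).

Definition generated (G : groupType) (A : set G) : set G :=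
  smallest (@is_subgroup G) A.

Definition normal_closure (G : groupType) (A : set G) : set G :=
  smallest (@is_normal_subgroup G) A.

Lemma generated_group_closed (G : groupType) (A : set G) :
  group_closed [pred x : G | `[< generated A x >]].
Proof.
split=> [|x y]; first by apply/asboolP => S [[]].
move=> /asboolP Ax /asboolP Ay; apply/asboolP => S [gS AS].
by case: (gS) => _ SM SV; apply: SM; [|apply: SV]; [apply: Ax|apply: Ay].
Qed.

(* The subgroup generated by [A], as a group in its own right. *)
Definition generated_type (G : groupType) (A : set G) : Type :=
  {x : G | `[< generated A x >]}.

HB.instance Definition _ (G : groupType) (A : set G) :=
  Choice.on (generated_type A).
HB.instance Definition _ (G : groupType) (A : set G) :=
  SubType.on (generated_type A).
HB.instance Definition _ (G : groupType) (A : set G) :=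
  SubChoice_isSubGroup.Build G _ (generated_type A) (generated_group_closed A).

Lemma mem_generated (G : groupType) (A : set G) (x : G) :
  A x -> `[< generated A x >].
Proof. by move=> Ax; apply/asboolP => S [_]; apply. Qed.

Definition gen_of (G : groupType) (A : set G) (x : G) (Ax : A x) :
  generated_type A := exist _ x (mem_generated Ax).

Definition gen2 (G : groupType) (g h : G) : groupType :=
  generated_type [set g; h].

Definition gen2_l (G : groupType) (g h : G) : gen2 g h :=
  gen_of (or_introl erefl : [set g; h] g).

Definition gen2_r (G : groupType) (g h : G) : gen2 g h :=
  gen_of (or_intror erefl : [set g; h] h).

(* The free group on [X] is the set of reduced words; the letter [(x, true)]
   stands for x and [(x, false)] for its inverse. *)

Definition letter_inv (X : Type) (l : X * bool) : X * bool := (l.1, ~~ l.2).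

Definition reduced (X : choiceType) (w : seq (X * bool)) : bool :=
  sorted (fun l m => m != letter_inv l) w.

(* Reduced form of [l :: w] when [w] is reduced. *)
Definition push (X : choiceType) (l : X * bool) (w : seq (X * bool)) :=
  if w is m :: w' then if m == letter_inv l then w' else l :: w else [:: l].

Definition reduced_mul (X : choiceType) (u v : seq (X * bool)) :=
  foldr (@push X) v u.

Definition word_inv (X : Type) (w : seq (X * bool)) :=
  rev (map (@letter_inv X) w).

Lemma letter_invK (X : Type) : involutive (@letter_inv X).
Proof. by move=> [x b]; rewrite /letter_inv /= negbK. Qed.

Lemma reduced_push (X : choiceType) (l : X * bool) w :
  reduced w -> reduced (push l w).
Proof.
case: w => [|m w] //= rw; case: ifP => [_|ml]; first exact: path_sorted rw.
by rewrite /reduced /= ml.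
Qed.

Lemma pushK (X : choiceType) (l : X * bool) w :
  reduced w -> push l (push (letter_inv l) w) = w.
Proof.
case: w => [|m w] /= rw; rewrite ?eqxx // letter_invK.
case: eqP rw => [->|_] rw /=; last by rewrite eqxx.
by case: w rw => [|n w] //= /andP[/negPf->].
Qed.

Lemma reduced_reduced_mul (X : choiceType) (u v : seq (X * bool)) :
  reduced v -> reduced (reduced_mul u v).
Proof. by move=> rv; elim: u => //= l u /(reduced_push l). Qed.

Lemma reduced_mul1 (X : choiceType) (u : seq (X * bool)) :
  reduced u -> reduced_mul u [::] = u.
Proof.
elim: u => [|l u IHu] //= ru.
rewrite IHu; last exact: path_sorted ru.
by case: u ru {IHu} => [|m u] //= /andP[/negPf->].
Qed.

Lemma reduced_mul_push (X : choiceType) (l : X * bool) (u v : seq (X * bool)) :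
  reduced v -> reduced_mul (push l u) v = push l (reduced_mul u v).
Proof.
move=> rv; case: u => [|m u] //=; case: eqP => [->|//].
by rewrite pushK //; apply: reduced_reduced_mul.
Qed.

Lemma reduced_mulA (X : choiceType) (u v w : seq (X * bool)) :
  reduced w ->
  reduced_mul u (reduced_mul v w) = reduced_mul (reduced_mul u v) w.
Proof. by move=> rw; elim: u => //= l u ->; rewrite reduced_mul_push. Qed.

Lemma reduced_mulV (X : choiceType) (u : seq (X * bool)) :
  reduced_mul (word_inv u) u = [::].
Proof.
elim: u => //= l u IHu; rewrite /word_inv /= rev_cons /reduced_mul foldr_rcons.
by rewrite /= letter_invK eqxx.
Qed.

Lemma reduced_word_inv (X : choiceType) (u : seq (X * bool)) :
  reduced u -> reduced (word_inv u).
Proof.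
rewrite /reduced /word_inv rev_sorted sorted_map; apply: sub_sorted => l m /=.
by apply: contra => /eqP ->; rewrite letter_invK.
Qed.

Lemma word_invK (X : Type) : involutive (@word_inv X).
Proof.
move=> u; rewrite /word_inv map_rev revK -map_comp -[RHS]map_id.
by apply: eq_map => l /=; rewrite letter_invK.
Qed.

Definition free_group (X : choiceType) : Type :=
  {w : seq (X * bool) | reduced w}.

HB.instance Definition _ (X : choiceType) := Choice.on (free_group X).
HB.instance Definition _ (X : choiceType) := SubType.on (free_group X).

Definition free_one (X : choiceType) : free_group X :=
  exist _ [::] isT.

Definition free_mul (X : choiceType) (u v : free_group X) : free_group X :=
  exist _ (reduced_mul (val u) (val v)) (reduced_reduced_mul (val u) (valP v)).

Definition free_inv (X : choiceType) (u : free_group X) : free_group X :=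
  exist _ (word_inv (val u)) (reduced_word_inv (valP u)).

Lemma free_mulA (X : choiceType) : associative (@free_mul X).
Proof. by move=> u v w; apply/val_inj/reduced_mulA/valP. Qed.

Lemma free_mul1g (X : choiceType) : left_id (free_one X) (@free_mul X).
Proof. by move=> u; apply/val_inj. Qed.

Lemma free_mulg1 (X : choiceType) : right_id (free_one X) (@free_mul X).
Proof. by move=> u; apply/val_inj/reduced_mul1/valP. Qed.

Lemma free_mulVg (X : choiceType) :
  left_inverse (free_one X) (@free_inv X) (@free_mul X).
Proof. by move=> u; apply/val_inj/reduced_mulV. Qed.

Lemma free_mulgV (X : choiceType) :
  right_inverse (free_one X) (@free_inv X) (@free_mul X).
Proof.
by move=> u; apply/val_inj; rewrite /= -{1}[val u]word_invK reduced_mulV.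
Qed.

HB.instance Definition _ (X : choiceType) :=
  isGroup.Build (free_group X) (@free_mulA X) (@free_mul1g X) (@free_mulg1 X)
    (@free_mulVg X) (@free_mulgV X).

Definition free_gen (X : choiceType) (x : X) : free_group X :=
  exist _ [:: (x, true)] isT.

Definition letter_eval (X : Type) (K : groupType) (f : X -> K) (l : X * bool) :
  K := if l.2 then f l.1 else (f l.1)^-1.

Definition free_lift (X : choiceType) (K : groupType) (f : X -> K)
  (w : free_group X) : K := \prod_(l <- val w) letter_eval f l.

Lemma letter_evalV (X : Type) (K : groupType) (f : X -> K) l :
  letter_eval f (letter_inv l) = (letter_eval f l)^-1.
Proof. by case: l => x [] //=; rewrite /letter_eval /= invgK. Qed.

Lemma prod_reduced_mul (X : choiceType) (K : groupType) (f : X -> K) u v :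
  \prod_(l <- reduced_mul u v) letter_eval f l =
  (\prod_(l <- u) letter_eval f l) * \prod_(l <- v) letter_eval f l.
Proof.
elim: u => [|l u IHu] /=; first by rewrite big_nil mul1g.
rewrite big_cons -mulgA -IHu; case: (reduced_mul u v) => [|m w] /=.
  by rewrite big_cons.
case: eqP => [->|_]; last by rewrite big_cons.
by rewrite big_cons letter_evalV mulgA mulgV mul1g.
Qed.

Lemma free_lift_inv (X : choiceType) (K : groupType) (f : X -> K) :
  {morph free_lift f : u / u^-1 >-> u^-1}.
Proof.
move=> u; apply: (mulIg (free_lift f u)); rewrite mulVg /free_lift.
by rewrite -prod_reduced_mul /= reduced_mulV big_nil.
Qed.

Lemma free_liftF (X : choiceType) (K : groupType) (f : X -> K) :
  {morph free_lift f : u v / u / v >-> u / v}.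
Proof.
by move=> u v; rewrite -free_lift_inv /free_lift /= prod_reduced_mul.
Qed.

HB.instance Definition _ (X : choiceType) (K : groupType) (f : X -> K) :=
  isGroupMorphism.Build (free_group X) K (free_lift f) (free_liftF f).

Lemma free_lift_gen (X : choiceType) (K : groupType) (f : X -> K) x :
  free_lift f (free_gen x) = f x.
Proof. by rewrite /free_lift big_seq1. Qed.

(* The two free generators x and y are indexed by [true] and [false]. *)
Definition F2 : groupType := free_group bool.
Definition F2x : F2 := free_gen true.
Definition F2y : F2 := free_gen false.

Definition F2_hom (K : groupType) (g h : K) : F2 -> K :=
  free_lift (fun b : bool => if b then g else h).

HB.instance Definition _ (K : groupType) (g h : K) :=
  isGroupMorphism.Build F2 K (F2_hom g h) (free_liftF _).

Definition free_over (K : groupType) (g h : K) : Prop :=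
  bijective (F2_hom g h).

(* To be used only when [g] and [h] generate [K]. *)
Definition has_presentation (K : groupType) (g h : K) (R : set F2) : Prop :=
  [set w : F2 | F2_hom g h w = 1] = normal_closure R.

(* Main.v *)
(** In the Cayley graph of G (edges x -> g x and x -> h x) a weak Sierpinski
    set E is crossed by exactly two edges, one g-edge and one h-edge.  Hence
    every g-edge (x, g x) forms a two-edge cut with the h-edge starting at c x,
    for a fixed c different from g, h^-1 and h^-1 g.  "Being equal or forming a
    cut" is an equivalence relation on edges, invariant under right translation,
    and a simple closed walk that meets a class runs through all of it.
    Uncrossing shows that the classes along such a walk do not interleave, so
    one of them is a run of consecutive edges.  The positive words g, h and h g
    have infinite order, because E is stable under g and h; with this, the
    shape of the run forces the two edges leaving any vertex to form a cut.
    Now a shortest relator outside a given normal subgroup N is a simple closed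
    walk, and using both or none of the two edges leaving each vertex it must be
    a cyclic conjugate of a power of h^-1 g or of its inverse.  Taking N to be
    the normal closure of (h^-1 g)^k, with k the order of h^-1 g, or N = 1 if
    this order is infinite, gives the theorem. *)

Require Import Defs.
From mathcomp Require Import all_boot.
From mathcomp Require Import boolp classical_sets.

Set Implicit Arguments.
Unset Strict Implicit.
Unset Printing Implicit Defensive.

Local Open Scope classical_set_scope.
Local Open Scope group_scope.

(** * Parity sums and noncrossing equivalence relations on an interval *)

Lemma telescope_addb (u e : nat -> bool) m :
  (forall k, (k < m)%N -> u k (+) u k.+1 = e k) ->
  u m = u 0 (+) \big[addb/false]_(k < m) e k.
Proof.
elim: m => [|m IH] H; first by rewrite big_ord0 addbF.
rewrite big_ord_recr /= addbA -IH => [|k km]; last by apply: H; apply: ltnW.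
by rewrite -H // addKb.
Qed.

Lemma sum_eq_addb i m : \big[addb/false]_(k < m) (k == i :> nat) = (i < m)%N.
Proof.
elim: m => [|m IH]; first by rewrite big_ord0.
rewrite big_ord_recr /= IH ltnS [(i <= m)%N]leq_eqVlt eq_sym.
by case: eqP => [->|]; rewrite ?ltnn // addbF.
Qed.

(* A noncrossing equivalence relation without singleton classes has a class
   that is an interval; the conclusion records only its first three elements. *)
Lemma noncrossing_interval_class (n : nat) (R : rel nat) :
  (0 < n)%N -> reflexive R -> symmetric R -> transitive R ->
  (forall i, (i < n)%N -> exists j, [/\ (j < n)%N, j != i & R i j]) ->
  (forall i j k l, (i < j < k)%N -> (k < l < n)%N -> R i k -> R j l -> R j k) ->
  exists i, [/\ (i.+1 < n)%N, R i i.+1 &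
    ((i.+2 < n)%N /\ R i.+1 i.+2) \/
    forall j, (j < n)%N -> R i j -> j = i \/ j = i.+1].
Proof.
move=> n0 Rxx Rsym Rtr Rex Rnc.
(* [wide i j] says that [i] and [j] are the two distinct extreme elements of one class. *)
pose wide i j := [/\ (i < j < n)%N, R i j &
  forall k, (k < n)%N -> R i k -> (i <= k <= j)%N].
have Pex i : (i < n)%N -> exists p q, wide p q /\ R i p.
  move=> ltin; pose P k := (k < n)%N && R i k.
  have Pi : exists k, P k by exists i; rewrite /P ltin Rxx.
  have Pub k : P k -> (k <= n)%N by case/andP=> /ltnW.
  case: (ex_minnP Pi) => p /andP[pn Rip] pmin.
  case: (ex_maxnP Pi Pub) => q /andP[qn Riq] qmax.
  exists p, q; split=> //.
  have Rp k : R p k = R i k by apply/idP/idP; [apply: Rtr|rewrite Rsym in Rip; apply: Rtr].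
  split=> [||k kn]; rewrite ?qn ?andbT ?Rp //; last first.
    by move=> Rik; rewrite pmin ?qmax // /P kn Rik.
  have [j [jn ji Rij]] := Rex i ltin.
  have Pj : P j by apply/andP.
  have Pi' : P i by rewrite /P ltin Rxx.
  have := pmin _ Pj; have := pmin _ Pi'; have := qmax _ Pj; have := qmax _ Pi'.
  rewrite ltnNge => iq jq pi pj; apply/negP => qp; case/eqP: ji.
  by apply/eqP; rewrite eqn_leq (leq_trans jq (leq_trans qp pi)) (leq_trans iq (leq_trans qp pj)).
have Qex : exists d, `[< exists p, wide p (p + d)%N >].
  have [p [q [w _]]] := Pex 0 n0; exists (q - p)%N; apply/asboolP; exists p.
  by rewrite subnKC //; case: w => /andP[/ltnW].
case: (ex_minnP Qex) => d /asboolP[p wpd] dmin.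
case: (wpd) => /andP[lt_p lt_n] Rpd sub.
(* The class of [p] has least span [d]. The class of a gap [m] could not cross it, so it would lie
   strictly between [p] and [p + d] and have smaller span. *)
have full m : (p <= m <= p + d)%N -> R p m.
  case/andP; rewrite leq_eqVlt => /orP[/eqP<-//|pm].
  rewrite leq_eqVlt => /orP[/eqP->//|mq].
  case: (boolP (R p m)) => // nRpm.
  have mn := ltn_trans mq lt_n.
  have [a [b [[/andP[ab bn] Rab subab] Rma]]] := Pex m mn.
  have mem k : (k < n)%N -> R m k -> (p < k < p + d)%N.
    move=> kn Rmk; have nRpk : ~~ R p k.
      by apply: contra nRpm => Rpk; apply: Rtr Rpk _; rewrite Rsym.
    have kp : k != p by apply: contraNneq nRpk => ->.
    have kq : k != (p + d)%N by apply: contraNneq nRpk => ->.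
    case: (ltngtP k p) kp => // [ltkp|ltpk] _.
      have Rkm : R k m by rewrite Rsym.
      have := @Rnc k p m (p + d) _ _ Rkm Rpd.
      rewrite ltkp pm mq lt_n => /(_ isT isT) /idP.
      by rewrite (negPf nRpm).
    case: (ltngtP k (p + d)) kq => // ltqk _.
    have := @Rnc p m (p + d) k _ _ Rpd Rmk.
    rewrite pm mq ltqk kn => /(_ isT isT) H.
    by move: nRpm; rewrite (Rtr _ _ _ Rpd) // Rsym.
  have [/andP[pa aq] /andP[pb bq]] := (mem a (ltn_trans ab bn) Rma, mem b bn (Rtr _ _ _ Rma Rab)).
  have := dmin (b - a)%N; rewrite leqNgt => /(_ _)/negP []; last first.
    by rewrite ltn_subLR ?(ltnW ab)// (leq_trans bq)// leq_add2r ltnW.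
  by apply/asboolP; exists a; rewrite subnKC // ?(ltnW ab)//; split=> //; rewrite ab.
have d0 : (0 < d)%N by rewrite -(ltn_add2l p) addn0.
exists p; split; first by rewrite (leq_ltn_trans _ lt_n).
  by apply: full; rewrite leqnSn.
case: (ltngtP d 1) => [||d1]; first by rewrite ltnS leqn0 => /eqP d00; rewrite d00 in d0.
  move=> d1; left; split; first by rewrite (leq_ltn_trans _ lt_n) // -addn2 leq_add2l.
  apply: (@Rtr p); first by rewrite Rsym full // leqnSn.
  by rewrite full // -addn2 leq_add2l leq_addr.
right=> j jn Rpj; have := sub j jn Rpj; rewrite d1 addn1 leq_eqVlt.
case/andP=> /orP[/eqP<-|pj]; first by left.
by move=> jp; right; apply/eqP; rewrite eqn_leq jp.
Qed.

(** * Walks and two-edge cuts in the Cayley graph *)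

Section Walks.
Variables (G : groupType) (f : bool -> G).
Implicit Types (s : seq (bool * bool)) (d e : bool * G) (phi : G -> bool).

Definition word_eval s : G := \prod_(l <- s) letter_eval f l.

Definition vertex s i := word_eval (drop i s).

Definition letter s i : bool * bool := nth (true, true) s i.

(* The edge [(b, x)] joins [x] to [f b * x].  The walk visits [vertex s i] in
   decreasing order of [i], its [i]-th step going from [vertex s i.+1] to
   [vertex s i]. *)
Definition edge s i : bool * G :=
  ((letter s i).1, if (letter s i).2 then vertex s i.+1 else vertex s i).

(* The last condition excludes the backtracking walk of length two. *)
Definition simple s : Prop :=
  [/\ word_eval s = 1, (0 < size s)%N,
    forall i j, (i < j <= size s)%N -> vertex s i = vertex s j ->
      i = 0 /\ j = size s &
    forall l, s <> [:: l; letter_inv l]].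

(** The mod 2 coboundary of a vertex set: it marks the edges with exactly one end in [phi]. *)
Definition cobound phi d := phi (f d.1 * d.2) (+) phi d.2.

(** For [d = e] the right-hand side vanishes, so equality is included; otherwise [d] and [e] form a
    two-edge cut. *)
Definition cut_equiv d e :=
  exists phi, forall c, cobound phi c = (c == d) (+) (c == e).

Lemma word_eval_cat s t : word_eval (s ++ t) = word_eval s * word_eval t.
Proof. exact: big_cat. Qed.

Lemma vertexS s i : (i < size s)%N ->
  vertex s i = letter_eval f (letter s i) * vertex s i.+1.
Proof. by move=> lti; rewrite /vertex (drop_nth (true, true)) // /word_eval big_cons. Qed.

Lemma cobound_edge s i phi : (i < size s)%N ->
  cobound phi (edge s i) = phi (vertex s i) (+) phi (vertex s i.+1).
Proof.
move=> lti; rewrite /cobound /edge /= (vertexS lti) /letter_eval.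
by case: (letter s i) => b [] //=; rewrite mulVKg addbC.
Qed.

Lemma cut_equiv_refl d : cut_equiv d d.
Proof. by exists xpred0 => c; rewrite /cobound !addbb. Qed.

Lemma cut_equiv_sym d e : cut_equiv d e -> cut_equiv e d.
Proof. by case=> phi cphi; exists phi => c; rewrite cphi addbC. Qed.

Lemma cut_equiv_trans d e c :
  cut_equiv d e -> cut_equiv e c -> cut_equiv d c.
Proof.
case=> phi cphi [psi cpsi]; exists (fun x => phi x (+) psi x) => u.
have -> : (u == d) (+) (u == c) = cobound phi u (+) cobound psi u.
  by rewrite cphi cpsi -addbA addKb.
by rewrite /cobound addbACA.
Qed.

(** Edges are given by left multiplication, so right translations are graph automorphisms. *)
Lemma cut_equiv_mulr (b b' : bool) (x y z : G) :
  cut_equiv (b, x) (b', y) -> cut_equiv (b, x * z) (b', y * z).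
Proof.
case=> phi cphi; exists (fun v => phi (v * z^-1)) => -[a v].
have := cphi (a, v * z^-1); rewrite /cobound /= mulgA => ->.
by rewrite !xpair_eqE !(can2_eq (mulgVK z) (mulgK z)).
Qed.

Section SimpleWalk.
Variable s : seq (bool * bool).
Hypothesis simple_s : simple s.
Local Notation n := (size s).

Lemma vertex0 : vertex s 0 = 1.
Proof. by rewrite /vertex drop0; case: simple_s. Qed.

Lemma vertex_size : vertex s n = 1.
Proof. by rewrite /vertex drop_size /word_eval big_nil. Qed.

Lemma vertex_injl i j : (i < n)%N -> (j < n)%N -> vertex s i = vertex s j -> i = j.
Proof.
case: simple_s => _ _ inj _.
wlog lij : i j / (i < j)%N.
  move=> IH lti ltj e; case: (ltngtP i j) => // lij; first exact: IH.
  by apply/esym/IH.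
move=> lti ltj e; have [|_ jn] := inj i j _ e; first by rewrite lij ltnW.
by rewrite jn ltnn in ltj.
Qed.

Lemma vertex_injr i j :
  (i < n)%N -> (j < n)%N -> vertex s i.+1 = vertex s j.+1 -> i = j.
Proof.
case: simple_s => _ _ inj _.
wlog lij : i j / (i < j)%N.
  move=> IH lti ltj e; case: (ltngtP i j) => // lij; first exact: IH.
  by apply/esym/IH.
by move=> lti ltj e; have [|] := inj i.+1 j.+1 _ e; rewrite // ltnS lij.
Qed.

Lemma vertex_injlr i j : (i < n)%N -> (j < n)%N -> vertex s i = vertex s j.+1 ->
  i = j.+1 \/ i = 0 /\ j.+1 = n.
Proof.
case: simple_s => _ _ inj _ lti ltj e.
case: (ltngtP i j.+1) => [lij|lij|->]; [right|left|by left].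
  by apply: inj e; rewrite lij.
by have [|//] := inj j.+1 i _ (esym e); rewrite lij ltnW.
Qed.

Lemma letter_not_inv i : (i.+1 < n)%N ->
  letter s i.+1 <> letter_inv (letter s i).
Proof.
move=> lti e; have lti' := ltnW lti.
have eqv : vertex s i = vertex s i.+2.
  by rewrite (vertexS lti') (vertexS lti) e letter_evalV mulVKg.
case: simple_s => _ _ inj nolr.
have [|i0 n2] := inj i i.+2 _ eqv; first by rewrite ltnS leqnSn.
apply: (nolr (letter s i)); move: n2 e; rewrite i0.
by case: (s) => [|a [|b [|c u]]] //= _ ->.
Qed.

Lemma letter_not_inv_wrap : letter s 0 <> letter_inv (letter s n.-1).
Proof.
case: (simple_s) => s1 n0 inj nolr e.
case: (ltngtP n 2) => [|n2|n2]; rewrite ?ltnS.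
- move=> n1; have n1E : n.-1 = 0 by apply/eqP; rewrite -leqn0 -ltnS prednK.
  move: e; rewrite n1E; by case: (letter s 0) => b [].
- have ltp : (n.-1 < n)%N by rewrite prednK.
  have v1 : vertex s 1 = vertex s n.-1.
    have := vertexS n0; have := vertexS ltp; rewrite prednK //.
    rewrite vertex0 vertex_size mulg1 e letter_evalV => -> e1.
    by rewrite -[LHS](mulVKg (letter_eval f (letter s n.-1))) -e1 mulg1.
  have [|//] := inj 1%N n.-1 _ v1.
  by rewrite leq_pred andbT -ltnS prednK.
- apply: (nolr (letter s 0)); move: e; rewrite n2 /letter /=; move: n2.
  by case: (s) => [|a [|b [|c u]]] //= _ ->; rewrite letter_invK.
Qed.

(** An edge repeated in the same direction repeats a vertex; in opposite directions, the two steps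
    are cyclically adjacent and form a backtrack. *)
Lemma edge_inj i j : (i < n)%N -> (j < n)%N -> edge s i = edge s j -> i = j.
Proof.
wlog lij : i j / (i < j)%N.
  move=> IH lti ltj e; case: (ltngtP i j) => // lij; first exact: IH.
  by apply/esym/IH.
move=> lti ltj; rewrite /edge; case Ei: (letter s i) => [b p].
case Ej: (letter s j) => [c q] /= [eb]; case: p q Ei Ej => [] [] Ei Ej.
- exact: vertex_injr.
- move/esym/(vertex_injlr ltj lti) => [ji|[j0]]; last by rewrite j0 in lij.
  by case: (@letter_not_inv i); rewrite -ji // Ei Ej eb.
- case/(vertex_injlr lti ltj) => [ij|[i0 jn]].
    by move: lij; rewrite ij ltnNge leqnSn.
  by case: letter_not_inv_wrap; rewrite -i0 -jn Ei Ej eb.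
- exact: vertex_injl.
Qed.

Lemma edge_eqE i j : (i < n)%N -> (j < n)%N -> (edge s i == edge s j) = (i == j).
Proof. by move=> lti ltj; apply/eqP/eqP => [/edge_inj->|->]. Qed.

(* A closed walk crosses every cut an even number of times. *)
Lemma cut_equiv_on_walk i e : (i < n)%N -> cut_equiv (edge s i) e ->
  exists2 j, (j < n)%N & edge s j = e.
Proof.
move=> lti [phi cphi]; apply: contrapT => none.
have := @telescope_addb (fun k => phi (vertex s k)) (fun k => k == i) n.
rewrite vertex_size vertex0 sum_eq_addb lti addbT => H.
suff /H : forall k, (k < n)%N -> phi (vertex s k) (+) phi (vertex s k.+1) = (k == i).
  by case: (phi 1).
move=> k ltk; rewrite -cobound_edge // cphi edge_eqE //.
case: (edge s k =P e) => [ke|_]; last by rewrite addbF.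
by case: none; exists k.
Qed.

Lemma cut_equiv_levels i j phi m : (i < n)%N -> (j < n)%N -> (m <= n)%N ->
  (forall c, cobound phi c = (c == edge s i) (+) (c == edge s j)) ->
  phi (vertex s m) = phi 1 (+) ((i < m)%N (+) (j < m)%N).
Proof.
move=> lti ltj lem cphi; rewrite -vertex0.
rewrite (@telescope_addb (fun k => phi (vertex s k))
  (fun k => (k == i) (+) (k == j))).
  by rewrite big_split /= !sum_eq_addb.
move=> k ltk; have ltkn := leq_trans ltk lem.
by rewrite -cobound_edge // cphi !edge_eqE.
Qed.

(* Uncrossing: the product of the two cuts, normalised to vanish at the base
   point of the walk, is again a cut. *)
Lemma cut_equiv_uncross i j k l : (i < j < k)%N -> (k < l < n)%N ->
  cut_equiv (edge s i) (edge s k) -> cut_equiv (edge s j) (edge s l) ->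
  cut_equiv (edge s j) (edge s k).
Proof.
case/andP=> ij jk /andP[kl ln] [phi cphi] [psi cpsi].
have kn := ltn_trans kl ln; have jn := ltn_trans jk kn.
have lti := ltn_trans ij jn.
pose phi' x := phi x (+) phi 1; pose psi' x := psi x (+) psi 1.
have cphi' c : cobound phi' c = (c == edge s i) (+) (c == edge s k).
  by rewrite -cphi /cobound /phi' addbACA addbb addbF.
have cpsi' c : cobound psi' c = (c == edge s j) (+) (c == edge s l).
  by rewrite -cpsi /cobound /psi' addbACA addbb addbF.
have phiE m : (m <= n)%N -> phi' (vertex s m) = (i < m)%N (+) (k < m)%N.
  by move=> mn; rewrite (cut_equiv_levels _ _ _ cphi') // /phi' addbb.
have psiE m : (m <= n)%N -> psi' (vertex s m) = (j < m)%N (+) (l < m)%N.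
  by move=> mn; rewrite (cut_equiv_levels _ _ _ cpsi') // /psi' addbb.
have offN m p : (m < p)%N -> ((p < m)%N = false) * ((p < m.+1)%N = false).
  by move=> lt; split; apply/negbTE; rewrite -leqNgt // ltnW.
have onN m p : (p < m)%N -> ((p < m)%N = true) * ((p < m.+1)%N = true).
  by move=> lt; rewrite ltnS lt (ltnW lt).
have selfN m : ((m < m)%N = false) * ((m < m.+1)%N = true).
  by rewrite ltnn ltnSn.
have ik := ltn_trans ij jk; have jl := ltn_trans jk kl; have il := ltn_trans ij jl.
(* On the walk, [phi'] holds at the vertices [i.+1..k] and [psi'] at [j.+1..l], hence both at
   [j.+1..k]. Away from the four edges neither changes. *)
exists (fun x => phi' x && psi' x) => c.
have [->|ni] := eqVneq c (edge s i).
  rewrite cobound_edge // !phiE ?psiE ?(ltnW lti) // !edge_eqE //.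
  by rewrite !(offN _ _ ij, offN _ _ il, offN _ _ ik, selfN, ltn_eqF ij, ltn_eqF ik).
have [->|nj] := eqVneq c (edge s j).
  rewrite cobound_edge // !phiE ?psiE ?(ltnW jn) // edge_eqE //.
  by rewrite !(offN _ _ jl, offN _ _ jk, onN _ _ ij, selfN, ltn_eqF jk).
have [->|nk] := eqVneq c (edge s k).
  rewrite cobound_edge // !phiE ?psiE ?(ltnW kn) //.
  by rewrite !(offN _ _ kl, onN _ _ ik, onN _ _ jk, selfN).
have [->|nl] := eqVneq c (edge s l).
  rewrite cobound_edge // !phiE ?psiE ?(ltnW ln) //.
  by rewrite !(onN _ _ kl, onN _ _ il, onN _ _ jl, onN _ _ ik, selfN).
have := cphi' c; have := cpsi' c.
rewrite (negPf ni) (negPf nj) (negPf nk) (negPf nl) /cobound.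
move: (phi' (_ * _)) (phi' c.2) (psi' (_ * _)) (psi' c.2).
by case=> [] [] [] [].
Qed.

End SimpleWalk.
End Walks.

(** * Classes of cut-equivalent edges *)

Section CutClasses.
Variables (G : groupType) (f : bool -> G).

Lemma cut_equiv_base b b' (x y : G) :
  cut_equiv f (b, x) (b', y) -> cut_equiv f (b, 1) (b', y * x^-1).
Proof. by move/(cut_equiv_mulr x^-1); rewrite mulgV. Qed.

(* The origin of the [b]-edge leaving ([out = true]) or entering the vertex 1. *)
Definition source b (out : bool) : G := if out then 1 else (f b)^-1.

(** With [edge_target], this describes the edges of steps [i] and [i.+1] from their common vertex
    [vertex f s i.+1]. *)
Lemma edge_source s i : (i < size s)%N ->
  edge f s i = ((letter s i).1,
                source (letter s i).1 (letter s i).2 * vertex f s i.+1).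
Proof.
move=> lti; rewrite /edge (vertexS f lti) /source /letter_eval.
by case: (letter s i) => b [] //=; rewrite mul1g.
Qed.

Lemma edge_target s i : (i < size s)%N ->
  edge f s i = ((letter s i).1,
                source (letter s i).1 (~~ (letter s i).2) * vertex f s i).
Proof.
move=> lti; rewrite /edge (vertexS f lti) /source /letter_eval.
by case: (letter s i) => b [] /=; rewrite ?mul1g ?mulKg.
Qed.

Section OnSimpleWalk.
Variable s : seq (bool * bool).
Hypothesis simple_s : simple f s.
Local Notation n := (size s).

(** Translating the cut links one edge to its translates by all powers of [u]. They all lie on the
    finite walk, so two powers coincide. *)
Lemma cut_equiv_torsion b (u : G) :
  (exists2 i, (i < n)%N & (edge f s i).1 = b) ->
  cut_equiv f (b, 1) (b, u) -> exists2 m, (0 < m)%N & u ^+ m = 1.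
Proof.
case=> i ltin; case Ei: (edge f s i) => [b' x] /= eb; rewrite eb in Ei => cu.
have step m : cut_equiv f (b, x) (b, u ^+ m * x).
  elim: m => [|m IH]; first by rewrite mul1g; apply: cut_equiv_refl.
  apply: cut_equiv_trans IH _.
  by have := cut_equiv_mulr (u ^+ m * x) cu; rewrite mul1g mulgA -expgS.
have onw m : exists j : 'I_n, edge f s j = (b, u ^+ m * x).
  have [|j ltj ej] := cut_equiv_on_walk simple_s ltin (e := (b, u ^+ m * x)).
    by rewrite Ei.
  by exists (Ordinal ltj).
have /choice [F FE] := onw.
have /injectivePn [k [k' kk' eF]] : ~~ injectiveb (fun k : 'I_n.+1 => F k).
  apply/negP => /injectiveP /leq_card; rewrite !card_ord ltnn //.
have epow : u ^+ k = u ^+ k'.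
  by have := FE k; rewrite eF FE => -[/mulIg].
wlog lt : k k' kk' {eF} epow / (k < k')%N.
  move=> IH; case: (ltngtP k k') => lkk; first exact: (IH k k').
    by apply: (IH k' k); rewrite 1?eq_sym.
  by case/eqP: kk'; apply: val_inj.
exists (k' - k)%N; first by rewrite subn_gt0.
by rewrite expgnFr ?(ltnW lt) // epow mulgV.
Qed.

Variable c : G.
Hypothesis cut_c : cut_equiv f (true, 1) (false, c).

Lemma cut_partner i : (i < n)%N -> exists j, [/\ (j < n)%N,
  cut_equiv f (edge f s i) (edge f s j) &
  if (edge f s i).1 then edge f s j = (false, c * (edge f s i).2)
  else edge f s j = (true, c^-1 * (edge f s i).2)].
Proof.
move=> lti; set e := edge f s i.
pose e' := if e.1 then (false, c * e.2) else (true, c^-1 * e.2).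
have ee' : cut_equiv f e e'.
  rewrite /e' {e'}; case: e => [] [] x /=.
    by have := cut_equiv_mulr x cut_c; rewrite mul1g.
  have := cut_equiv_mulr (c^-1 * x) cut_c; rewrite mul1g mulVKg.
  exact: cut_equiv_sym.
have [j ltj ej] := cut_equiv_on_walk simple_s lti ee'.
by exists j; split; rewrite ?ej // /e'; case: e.1.
Qed.

Lemma label_on_walk b : exists2 i, (i < n)%N & (edge f s i).1 = b.
Proof.
have n0 : (0 < n)%N by case: simple_s.
have [j [ltj _]] := cut_partner n0.
have [<- _|nb] := eqVneq (edge f s 0).1 b; first by exists 0.
by move=> ej; exists j => //; move: nb ej; case: (edge f s 0) => [] [] x; case: (b) => // _ ->.
Qed.

Hypothesis free_true : forall m, (0 < m)%N -> f true ^+ m <> 1.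
Hypothesis free_false : forall m, (0 < m)%N -> f false ^+ m <> 1.
Hypothesis free_mul : forall m, (0 < m)%N -> (f false * f true) ^+ m <> 1.

Lemma label_free b m : (0 < m)%N -> f b ^+ m <> 1.
Proof. by case: b; [apply: free_true|apply: free_false]. Qed.

(* The [z] for which the [true]- and [false]-edges occupying the two given slots
   at a vertex start at [x] and [z * x]. *)
Definition slot_quotient (p : bool * bool) : G :=
  source false p.2 * (source true p.1)^-1.

Lemma cut_quotient_torsion (z z' : G) :
  cut_equiv f (true, 1) (false, z) -> cut_equiv f (true, 1) (false, z') ->
  exists2 m, (0 < m)%N & (z'^-1 * z) ^+ m = 1.
Proof.
move=> cz cz'; apply: (cut_equiv_torsion (label_on_walk true)).
apply: cut_equiv_trans cz _.
have /cut_equiv_sym := cut_equiv_mulr (z'^-1 * z) cz'.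
by rewrite mul1g mulVKg.
Qed.

(** With g = [f true] and h = [f false], the slot quotients are 1, g, h^-1 and h^-1 g. For two
    distinct ones other than 1, the torsion element z'^-1 z is, in a suitable order, h g, g or a
    conjugate of h, which is impossible. *)
Lemma slot_quotient_unique p q : p != q ->
  cut_equiv f (true, 1) (false, slot_quotient p) ->
  cut_equiv f (true, 1) (false, slot_quotient q) ->
  cut_equiv f (true, 1) (false, 1).
Proof.
have tors : forall z z' : G, cut_equiv f (true, 1) (false, z) ->
    cut_equiv f (true, 1) (false, z') ->
    (forall m, (0 < m)%N -> (z'^-1 * z) ^+ m <> 1) ->
    cut_equiv f (true, 1) (false, 1).
  by move=> z z' cz cz' H; have [m /H] := cut_quotient_torsion cz cz'.
have freeJ m : (0 < m)%N -> ((f true)^-1 * (f false * f true)) ^+ m <> 1.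
  move=> m0 /eqP; rewrite -/(conjg _ _) -conjXg conjg_eq1 => /eqP.
  exact: free_false.
rewrite /slot_quotient /source.
case: p q => [] [] [] [[] []] //= _; rewrite ?invg1 ?invgK ?mul1g ?mulg1 // => cz cz'.
all: first
  [ by apply: (tors _ _ cz cz') => m m0; rewrite ?invgM ?invgK -?mulgA ?mulVKg;
    first [exact: free_mul | exact: free_true | exact: freeJ]
  | by apply: (tors _ _ cz' cz) => m m0; rewrite ?invgM ?invgK -?mulgA ?mulVKg;
    first [exact: free_mul | exact: free_true | exact: freeJ] ].
Qed.

(** With equal labels, absence of backtracking makes the directions agree; the edges then differ by
    [f b] or its inverse, which has infinite order. *)
Lemma adjacent_labels i : (i.+1 < n)%N ->
  cut_equiv f (edge f s i) (edge f s i.+1) ->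
  (letter s i.+1).1 = ~~ (letter s i).1.
Proof.
move=> lti; rewrite (edge_source (ltnW lti)) (edge_target lti).
have := letter_not_inv simple_s lti.
case: (letter s i) (letter s i.+1) => [b p] [b' p'] /=.
have [<-{b'}|] := eqVneq b b'; last by case: b b' => [] [].
have [->|] := eqVneq p' p; last first.
  by rewrite /letter_inv /=; case: p p' => [] [].
move=> _ /cut_equiv_base; rewrite invgM mulgA mulgK => ce.
have {ce}[m m0] := cut_equiv_torsion (label_on_walk b) ce.
rewrite /source; case: (p) => /=; rewrite ?invg1 ?invgK ?mul1g ?mulg1.
  by rewrite expVgn => /eqP; rewrite invg_eq1 => /eqP /(label_free m0).
by move/(label_free m0).
Qed.

(** Outgoing flags of the [true]- and [false]-edge at [vertex f s i.+1], for differing labels. Step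
    [i.+1] arrives there, whence the negation. *)
Definition slots i : bool * bool :=
  if (letter s i).1 then ((letter s i).2, ~~ (letter s i.+1).2)
  else (~~ (letter s i.+1).2, (letter s i).2).

Lemma adjacent_slots i : (i.+1 < n)%N ->
  cut_equiv f (edge f s i) (edge f s i.+1) ->
  cut_equiv f (true, 1) (false, slot_quotient (slots i)).
Proof.
move=> lti ce; have := adjacent_labels lti ce; move: ce.
rewrite (edge_source (ltnW lti)) (edge_target lti) /slots.
case: (letter s i) (letter s i.+1) => [b p] [b' p'] /= ce eb.
rewrite {b'}eb in ce; case: b ce => /=; last move/cut_equiv_sym.
  by move/cut_equiv_base; rewrite invgM mulgA mulgK.
by move/cut_equiv_base; rewrite invgM mulgA mulgK.
Qed.

(* An innermost class of cut-equivalent edges is a run of consecutive edges.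
   Two consecutive pairs in the run involve different slots, and a run of
   length two forces [c] to be one of the four slot quotients. *)
Lemma cut_equiv_diagonal : c <> f true -> c <> (f false)^-1 ->
  c <> (f false)^-1 * f true -> cut_equiv f (true, 1) (false, 1).
Proof.
move=> ng nh nt; pose R i j := `[< cut_equiv f (edge f s i) (edge f s j) >].
have Rtr : transitive R.
  move=> j i k /asboolP cij /asboolP cjk; apply/asboolP.
  exact: cut_equiv_trans cij cjk.
have n0 : (0 < n)%N by case: simple_s.
have [|||||i [lti /asboolP Ri]] := @noncrossing_interval_class n R n0.
- by move=> i; apply/asboolP/cut_equiv_refl.
- by move=> i j; apply/asboolP/asboolP; apply: cut_equiv_sym.
- exact: Rtr.
- move=> i lti; have [j [ltj ce ej]] := cut_partner lti.
  exists j; split=> //; last exact/asboolP.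
  apply: contraPneq ej => ->; by case: (edge f s i) => [] [] x.
- move=> i j k l ijk kln /asboolP cik /asboolP cjl; apply/asboolP.
  exact: (cut_equiv_uncross simple_s ijk kln).
have cz := adjacent_slots lti Ri; have lab := adjacent_labels lti Ri.
case=> [[lti2 /asboolP Ri']|cls].
  have cz' := adjacent_slots lti2 Ri'; have lab' := adjacent_labels lti2 Ri'.
  (* The middle edge leaves one of its ends and enters the other, so the two slot pairs differ. *)
  apply: slot_quotient_unique cz cz'; move: lab lab'; rewrite /slots.
  case: (letter s i) (letter s i.+1) (letter s i.+2) => [b p] [b' p'] [b'' p''] /= -> _.
  by case: b; rewrite xpair_eqE; case: (p'); rewrite ?andbF.
(* Three of the four slot quotients are excluded by hypothesis, which leaves [c = 1]. *)
suff ec : c = slot_quotient (slots i).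
  have := cut_c; rewrite ec; move: ec; rewrite /slot_quotient /source.
  by case: (slots i) => [] [] [] /=; rewrite ?invg1 ?invgK ?mul1g ?mulg1.
have ei := edge_source (ltnW lti); have ei' := edge_target lti.
have eqc k k' x y : edge f s k = (true, x) -> edge f s k' = (false, y) ->
    (k < n)%N -> (R i k) -> (k = i /\ k' = i.+1 \/ k = i.+1 /\ k' = i) -> y = c * x.
  move=> ek ek' ltk Rik kk'; have [j [ltj ckj]] := cut_partner ltk.
  rewrite ek /= => ej.
  have Rij : R i j by apply: Rtr Rik _; apply/asboolP.
  have jk : j <> k by move=> jk; move: ej; rewrite jk ek.
  suff jk' : j = k' by move: ej; rewrite jk' ek' => -[].
  by have := cls j ltj Rij; case: kk' jk => [] [-> ->] jk [].
move: ei ei' lab; rewrite /slots /slot_quotient.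
case: (letter s i) (letter s i.+1) => [b p] [b' p'] /= ei ei' eb.
rewrite {b'}eb in ei'; case: b ei ei' => /= ei ei'.
  have Rii : R i i by apply/asboolP/cut_equiv_refl.
  have := eqc i i.+1 _ _ ei ei' (ltnW lti) Rii (or_introl (conj erefl erefl)).
  by rewrite mulgA => /mulIg ->; rewrite mulgK.
have Rii : R i i.+1 by apply/asboolP.
have := eqc i.+1 i _ _ ei' ei lti Rii (or_intror (conj erefl erefl)).
by rewrite mulgA => /mulIg ->; rewrite mulgK.
Qed.

End OnSimpleWalk.

Definition flip (l : bool * bool) : bool * bool := (~~ l.1, ~~ l.2).

(* If the two edges leaving each vertex always form a cut, a simple closed walk
   uses both or none of them, hence alternates between the two labels. *)
Lemma simple_alternating s : simple f s ->
  cut_equiv f (true, 1) (false, 1) ->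
  exists l m, s = mkseq (fun i => if odd i then flip l else l) m.*2.
Proof.
move=> simple_s cut1; set n := size s.
have n0 : (0 < n)%N by case: (simple_s).
have out_partner i : (i < n)%N -> exists2 j, (j < n)%N &
    edge f s j = (~~ (edge f s i).1, (edge f s i).2).
  move=> lti; have [j [ltj _ ej]] := cut_partner simple_s cut1 lti; exists j => //.
  by move: ej; case: (edge f s i) => [] [] x /=; rewrite ?invg1 mul1g.
(* The other edge leaving the start of step [i] is also on the walk, and only the step arriving
   there, cyclically [i.+1], can use it. For an inverse letter, [neg] argues at the end of the
   step. *)
have pos i : (i < n)%N -> (letter s i).2 ->
    letter s (if i.+1 == n then 0 else i.+1) = flip (letter s i).
  move=> lti pi; have [j ltj] := out_partner i lti.
  rewrite /edge pi; case Ej: (letter s j) => [b []] /= [eb ev].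
    have ij := vertex_injr simple_s ltj lti ev.
    by move: eb; rewrite -ij Ej /=; case: (b).
  have -> : (if i.+1 == n then 0 else i.+1) = j.
    have [ji|[-> ->]] := vertex_injlr simple_s ltj lti ev; last by rewrite eqxx.
    by rewrite -ji; case: eqP ltj => // ->; rewrite ltnn.
  by rewrite Ej eb /flip pi.
have neg i : (i < n)%N -> ~~ (letter s i).2 ->
    letter s (if i == 0 then n.-1 else i.-1) = flip (letter s i).
  move=> lti pi; have [j ltj] := out_partner i lti.
  rewrite /edge (negPf pi); case Ej: (letter s j) => [b []] /= [eb ev]; last first.
    have ij := vertex_injl simple_s ltj lti ev.
    by move: eb; rewrite -ij Ej /=; case: (b).
  have -> : (if i == 0 then n.-1 else i.-1) = j.
    have [->//|[-> jn]] := vertex_injlr simple_s lti ltj (esym ev).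
    by rewrite eqxx /n -jn.
  by rewrite Ej eb /flip (negPf pi).
(* If neither [pos i] nor [neg i.+1] applies, the signs already differ, and the labels differ by
   absence of backtracking. *)
have succ i : (i.+1 < n)%N -> letter s i.+1 = flip (letter s i).
  move=> lti; have := pos i (ltnW lti); rewrite (ltn_eqF lti).
  have : ~~ (letter s i.+1).2 -> letter s i = flip (letter s i.+1) := neg i.+1 lti.
  move: (letter_not_inv simple_s lti).
  case: (letter s i) (letter s i.+1) => [b p] [b' p'].
  by case: b p b' p' => [] [] [] [] //= H1 H2 H3;
    first [done | by case: H1 | by have := H2 isT | by have := H3 isT].
have flipK l : flip (flip l) = l by rewrite /flip /= !negbK; case: l.
have all i : (i < n)%N ->
    letter s i = if odd i then flip (letter s 0) else letter s 0.
  elim: i => [|i IH] // lti; rewrite succ // IH ?(ltnW lti) //=.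
  by case: (odd i) => //=; rewrite flipK.
have nflip l : l <> flip l by case: l => [] [].
(* For odd [n] the first and last letters would agree, against [pos] or [neg] across the base
   point. *)
have evn : ~~ odd n.
  apply/negP => on; have ltp : (n.-1 < n)%N by rewrite prednK.
  have ep : letter s n.-1 = letter s 0.
    by rewrite all // -[odd _]negbK -oddS prednK // on.
  have [p0|/(neg 0 n0)] := boolP (letter s 0).2; last by rewrite eqxx ep => /nflip.
  by have := pos n.-1 ltp; rewrite ep prednK // eqxx => /(_ p0) /nflip.
exists (letter s 0), n./2; apply: (@eq_from_nth _ (true, true)).
  by rewrite size_mkseq even_halfK.
by move=> i lti; rewrite nth_mkseq ?even_halfK // -/(letter s i) all.
Qed.

End CutClasses.

(** * The cut of a weak Sierpinski set *)

Lemma translate_setD1 (G : groupType) (k a : G) (E : set G) :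
  E a -> [set k * x | x in E] = E `\ a ->
  [/\ forall x, E x -> E (k * x), ~ E (k^-1 * a) &
    forall x, `[< E (k * x) >] (+) `[< E x >] = (x == k^-1 * a)].
Proof.
move=> Ea kE; have fwd x : E x -> E (k * x) /\ k * x <> a.
  by move=> Ex; have : (E `\ a) (k * x) by rewrite -kE; exists x.
have nEa : ~ E (k^-1 * a) by move/fwd => [_]; rewrite mulVKg.
split=> [x /fwd[]|//|x] //.
have [->|xa] := eqVneq x (k^-1 * a).
  by rewrite mulVKg (asboolT Ea) (asboolF nEa).
suff -> : `[< E (k * x) >] = `[< E x >] by rewrite addbb.
apply/asboolP/asboolP => [Ekx|/fwd[]//].
have : [set k * x | x in E] (k * x).
  by rewrite kE; split=> // kxa; case/eqP: xa; rewrite -kxa mulKg.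
by case=> y Ey /mulgI <-.
Qed.

(** If [u] had finite order, [u^-1] would be a nonnegative power of [u] and so preserve [E]. *)
Lemma forward_invariant_torsion_free (G : groupType) (u x : G) (E : set G) :
  (forall y, E y -> E (u * y)) -> E x -> ~ E (u^-1 * x) ->
  forall m, (0 < m)%N -> u ^+ m <> 1.
Proof.
move=> fwd Ex nEx [//|m] _; rewrite expgSr => um.
case: nEx; have <- : u ^+ m = u^-1 by apply: (mulIg u); rewrite um mulVg.
by elim: m {um} => [|m IH]; rewrite ?mul1g // expgS -mulgA; apply: fwd.
Qed.

Lemma wS_subset_diagonal (G : groupType) (g h : G) (E : set G) s :
  wS_subset g h E ->
  simple (fun b : bool => if b then g else h) s ->
  cut_equiv (fun b : bool => if b then g else h) (true, 1) (false, 1).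
Proof.
set f := (fun b : bool => _) => -[a [b [Ea Eb ab gE hE]]] simple_s.
have [gfwd nga cobg] := translate_setD1 Ea gE.
have [hfwd nhb cobh] := translate_setD1 Eb hE.
have cut : cut_equiv f (true, g^-1 * a) (false, h^-1 * b).
  exists (fun x => `[< E x >]) => -[[] x]; rewrite /cobound /= !xpair_eqE /=.
    by rewrite cobg addbF.
  exact: cobh.
apply: (cut_equiv_diagonal simple_s (cut_equiv_base cut)) => /=.
- exact: forward_invariant_torsion_free gfwd Ea nga.
- exact: forward_invariant_torsion_free hfwd Eb nhb.
- apply: (forward_invariant_torsion_free _ Eb).
    by move=> y /gfwd /hfwd; rewrite mulgA.
  by rewrite invgM -mulgA => /gfwd; rewrite mulVKg.
(* Here c = h^-1 b a^-1 g. The three excluded values would give in turn h^-1 b = a, g^-1 a = b and a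
   = b. *)
- rewrite invgM invgK mulgA => /(canRL (mulgK g)); rewrite mulgV.
  by move/(canRL (mulgVK a)); rewrite mul1g => e; apply: nhb; rewrite e.
- rewrite -[RHS]mulg1 -mulgA => /mulgI /(canRL (mulgK _)).
  by rewrite invgK mul1g => e; apply: nga; rewrite -e.
- rewrite -mulgA => /mulgI; rewrite invgM invgK mulgA => /(canRL (mulgK g)).
  by rewrite mulgV => /(canRL (mulgVK a)); rewrite mul1g => /esym.
Qed.

Lemma wS_subset_neq (G : groupType) (g h : G) (E : set G) :
  wS_subset g h E -> g <> h.
Proof.
case=> a [b [Ea Eb ab gE hE]] gh.
have : (E `\ a) b by split=> // /esym.
by rewrite -gE gh hE => -[_ []].
Qed.

(** * Normal subgroups and relators *)

Section NormalSubgroups.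
Variables (K : groupType) (N : set K).
Hypothesis normalN : is_normal_subgroup N.

Lemma normal_mem1 : N 1. Proof. by case: normalN => -[]. Qed.

Lemma normal_memM x y : N x -> N y -> N (x * y).
Proof. by case: normalN => -[_ + _] _; apply. Qed.

Lemma normal_memV x : N x^-1 <-> N x.
Proof.
by case: normalN => -[_ _ NV] _; split=> /NV //; rewrite invgK.
Qed.

Lemma normal_memJ x y : N (x ^ y) <-> N x.
Proof.
case: normalN => _ NJ; split=> [/(NJ _ y^-1)|/NJ //].
by rewrite -conjgM mulgV conjg1.
Qed.

Lemma normal_memX x m : N x -> N (x ^+ m).
Proof.
move=> Nx; elim: m => [|m IH]; first exact: normal_mem1.
by rewrite expgS; apply: normal_memM.
Qed.

Lemma normal_mem_mid x y z : N (x * z) -> N y -> N (x * y * z).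
Proof.
move=> Nxz Ny; have -> : x * y * z = x * z * y ^ z.
  by rewrite conjgE !mulgA mulgK.
by apply: normal_memM; [|apply/normal_memJ].
Qed.

(** The four alternating products of two letters are h^-1 g, its conjugate g h^-1, and their
    inverses. *)
Lemma normal_mem_alternating (f : bool -> K) l m :
  N ((letter_eval f l * letter_eval f (flip l)) ^+ m) <->
  N (((f false)^-1 * f true) ^+ m).
Proof.
case: l => [] [] []; rewrite /letter_eval /flip //=.
- by rewrite -(normal_memJ _ (f false)) conjXg conjgE mulgVK.
- have -> : (f true)^-1 * f false = ((f false)^-1 * f true)^-1.
    by rewrite invgM invgK.
  by rewrite expVgn; apply: normal_memV.
- have -> : f false * (f true)^-1 = (f true * (f false)^-1)^-1.
    by rewrite invgM invgK.
  by rewrite expVgn normal_memV -(normal_memJ _ (f false)) conjXg conjgE mulgVK.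
Qed.

End NormalSubgroups.

Lemma word_eval_alternating (K : groupType) (f : bool -> K) l m :
  word_eval f (mkseq (fun i => if odd i then flip l else l) m.*2) =
  (letter_eval f l * letter_eval f (flip l)) ^+ m.
Proof.
rewrite /word_eval; elim: m => [|m IH]; first by rewrite big_nil.
rewrite doubleS 2!mkseqS -!cats1 !big_cat !big_seq1 IH expgSr /=.
by rewrite odd_double mulgA.
Qed.

Lemma trivial_normal (K : groupType) : is_normal_subgroup [set 1 : K].
Proof.
split; first split=> [//|x y -> ->|x ->]; rewrite /= ?mulg1 ?invg1 //.
by move=> x y ->; rewrite /= conj1g.
Qed.

Lemma normal_closure_normal (K : groupType) (A : set K) :
  is_normal_subgroup (normal_closure A).
Proof.
split=> [|x y Ax S [nS AS]]; last by apply/(normal_memJ nS); apply: Ax.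
split=> [S [nS _]|x y Ax Ay S [nS AS]|x Ax S [nS AS]].
- exact: normal_mem1.
- by apply: (normal_memM nS); [apply: Ax|apply: Ay].
- by apply/(normal_memV nS); apply: Ax.
Qed.

Lemma sub_normal_closure (K : groupType) (A : set K) : A `<=` normal_closure A.
Proof. by move=> x Ax S [_]; apply. Qed.

Lemma kernel_normal (K L : groupType) (phi : UMagmaMorphism.type K L) :
  is_normal_subgroup [set x | phi x = 1].
Proof.
split; first split=> [|x y|x] /=; rewrite ?gmulf1 ?gmulfM ?gmulfV //.
- by move=> -> ->; rewrite mulg1.
- by move=> ->; rewrite invg1.
by move=> x y /=; rewrite gmulfJ => ->; rewrite conj1g.
Qed.

Lemma free_word_eval (w : F2) : word_eval (@free_gen bool) (val w) = w.
Proof.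
apply/val_inj; have gv l : val (letter_eval (@free_gen bool) l) = [:: l].
  by case: l => b [].
rewrite -[RHS](reduced_mul1 (valP w)); elim: (val w) => [|l u IH] /=.
  by rewrite /word_eval big_nil.
by rewrite /word_eval big_cons /= gv -IH.
Qed.

Lemma F2_hom_word_eval (K : groupType) (g h : K) s :
  F2_hom g h (word_eval (@free_gen bool) s) =
  word_eval (fun b : bool => if b then g else h) s.
Proof.
rewrite /word_eval gmulf_prod; apply: eq_bigr => -[b p] _.
by case: p; rewrite /letter_eval /= ?gmulfV; [|congr (_^-1)]; exact: free_lift_gen.
Qed.

(** In a shortest relator outside [N], a repeated vertex would split off a closed subword; it and
    the remaining word are shorter relators, hence in [N], and so is the whole. *)
Lemma shortest_word_simple (K : groupType) (g h : K) (N : set F2) :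
  is_normal_subgroup N -> (exists2 w, F2_hom g h w = 1 & ~ N w) ->
  exists2 s, simple (fun b : bool => if b then g else h) s &
    ~ N (word_eval (@free_gen bool) s).
Proof.
set f := (fun b : bool => _); set fw := word_eval _.
move=> nN [w0 kw0 nw0].
have ex : exists m, `[< exists s, [/\ size s = m, word_eval f s = 1 & ~ N (fw s)] >].
  exists (size (val w0)); apply/asboolP; exists (val w0); split=> //.
  by rewrite /fw free_word_eval.
case: (ex_minnP ex) => m /asboolP[s [sm ks ns]] mmin; exists s => //.
have short u : (size u < size s)%N -> word_eval f u = 1 -> N (fw u).
  move=> us ku; apply: contrapT => nu.
  have : (m <= size u)%N by apply: mmin; apply/asboolP; exists u.
  by rewrite leqNgt -sm us.
split=> // [|i j /andP[ij js] eij|l sl].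
- rewrite lt0n size_eq0; apply: contra_notN ns => /eqP ->.
  by rewrite /fw /word_eval big_nil; apply: normal_mem1.
- apply: contrapT => nij; apply: ns.
  pose u := take i s; pose v := drop i (take j s); pose t := drop j s.
  have svt : drop i s = v ++ t.
    by rewrite -[in LHS](cat_take_drop j s) drop_cat size_takel // ij.
  have sE : s = u ++ v ++ t by rewrite -svt cat_take_drop.
  have kv : word_eval f v = 1.
    move: eij; rewrite /vertex svt word_eval_cat => e.
    by apply: (mulIg (word_eval f t)); rewrite mul1g.
  have sv : size v = (j - i)%N by rewrite size_drop size_takel.
  have kut : word_eval f (u ++ t) = 1.
    by move: ks; rewrite sE !word_eval_cat kv mul1g.
  rewrite sE /fw !word_eval_cat mulgA; apply: normal_mem_mid => //.
    rewrite -word_eval_cat; apply: short => //.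
    by rewrite [in X in (_ < X)%N]sE !size_cat sv addnA ltn_add2r
      -[X in (X < _)%N]addn0 ltn_add2l subn_gt0.
  apply: short => //; rewrite sv; rewrite ltnNge; apply/negP => le.
  apply: nij; suff : i = 0 /\ j = size s by [].
  move: le ij js; clear; move: (size s) => n le ij js.
  have i0 : i = 0.
    apply/eqP; rewrite -leqn0 -(leq_add2l (j - i)) addn0 subnK ?(ltnW ij) //.
    exact: leq_trans js le.
  by split=> //; apply/eqP; rewrite eqn_leq js; move: le; rewrite i0 subn0.
- apply: ns; rewrite sl /fw /word_eval big_cons big_seq1 letter_evalV mulgV.
  exact: normal_mem1.
Qed.

Lemma kernel_sub_normal (K : groupType) (g h : K) (N : set F2) :
  is_normal_subgroup N ->
  (forall s, simple (fun b : bool => if b then g else h) s ->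
    cut_equiv (fun b : bool => if b then g else h) (true, 1) (false, 1)) ->
  (forall m, (h^-1 * g) ^+ m = 1 -> N ((F2y^-1 * F2x) ^+ m)) ->
  forall w, F2_hom g h w = 1 -> N w.
Proof.
move=> nN diag tN w kw; apply: contrapT => nw.
have [s simple_s] := shortest_word_simple nN (ex_intro2 _ _ w kw nw); apply.
have [l [m sE]] := simple_alternating simple_s (diag s simple_s).
rewrite sE word_eval_alternating; apply/normal_mem_alternating => //.
apply: tN; apply/(normal_mem_alternating (trivial_normal K)
  (fun b : bool => if b then g else h) l m).
by rewrite -word_eval_alternating -sE; case: simple_s.
Qed.

(** * Passage to the generated subgroup and conclusion *)

Lemma val_F2_hom_gen2 (G : groupType) (g h : G) w :
  val (F2_hom (gen2_l g h) (gen2_r g h) w) = F2_hom g h w.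
Proof.
rewrite -[w]free_word_eval !F2_hom_word_eval /word_eval.
elim: (val w) => [|l u IH]; first by rewrite !big_nil.
rewrite !big_cons /= -IH; congr (_ * _).
by case: l => [] [] [].
Qed.

Lemma F2_hom_gen2_eq1 (G : groupType) (g h : G) w :
  F2_hom (gen2_l g h) (gen2_r g h) w = 1 <-> F2_hom g h w = 1.
Proof.
rewrite -(val_F2_hom_gen2 g h); split=> [->//|e].
exact: val_inj.
Qed.

Lemma F2_hom_gen2_surj (G : groupType) (g h : G) (y : gen2 g h) :
  exists w, F2_hom (gen2_l g h) (gen2_r g h) w = y.
Proof.
have /asboolP gy := valP y.
have [w _ ew] : range (F2_hom g h) (val y).
  apply: gy; split.
    split=> [|_ _ [u _ <-] [v _ <-]|_ [u _ <-]].
    - by exists 1 => //; rewrite gmulf1.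
    - by exists (u * v) => //; rewrite gmulfM.
    - by exists u^-1 => //; rewrite gmulfV.
  by move=> _ [->|->]; [exists F2x|exists F2y] => //; exact: free_lift_gen.
by exists w; apply: val_inj; rewrite val_F2_hom_gen2.
Qed.

Lemma F2_hom_gen2_free (G : groupType) (g h : G) :
  (forall w, F2_hom g h w = 1 -> w = 1) ->
  free_over (gen2_l g h) (gen2_r g h).
Proof.
move=> inj; have [k kK] := choice (@F2_hom_gen2_surj _ g h).
exists k => // w; apply: (@gmulf_inj _ _ (F2_hom (gen2_l g h) (gen2_r g h))).
  by move=> u /F2_hom_gen2_eq1 /inj.
exact: kK.
Qed.

Theorem mainTheorem1 (G : groupType) (g h : G) :
  (exists E : set G, wS_subset g h E) ->
  free_over (gen2_l g h) (gen2_r g h) \/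
  exists2 k : nat, (2 <= k)%N &
    has_presentation (gen2_l g h) (gen2_r g h) [set (F2y^-1 * F2x) ^+ k].
Proof.
case=> E wSE; have diag s := @wS_subset_diagonal _ _ _ _ s wSE.
have [[k k0 tk]|tfree] := pselect (exists2 k, (0 < k)%N & (h^-1 * g) ^+ k = 1).
  right; have ex : exists k, (0 < k)%N && ((h^-1 * g) ^+ k == 1).
    by exists k; rewrite k0 tk eqxx.
  case: (ex_minnP ex) => {k0 tk} {}k /andP[k0 /eqP tk] kmin; exists k.
    (* Order 1 would mean [g = h]. *)
    rewrite ltn_neqAle k0 andbT; apply/eqP => k1.
    apply: (wS_subset_neq wSE); move: tk; rewrite -k1 expg1 => e.
    by rewrite -[g](mulVKg h) e mulg1.
  apply/seteqP; split=> w /=.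
    move/F2_hom_gen2_eq1; apply: kernel_sub_normal => //.
      exact: normal_closure_normal.
    (* Minimality of [k] forces the remainder [r] to vanish. *)
    move=> m tm; have := divn_eq m k; set r := (m %% k)%N => mE.
    have tr : (h^-1 * g) ^+ r = 1.
      by move: tm; rewrite mE expgnDr mulnC expgnA tk expg1n mul1g.
    have r0 : r = 0.
      apply/eqP; rewrite -leqn0 leqNgt; apply/negP => r0.
      have := kmin r; rewrite r0 tr eqxx => /(_ isT).
      by rewrite leqNgt ltn_mod k0.
    rewrite mE r0 addn0 mulnC expgnA; apply: (normal_memX (normal_closure_normal _)).
    exact: sub_normal_closure.
  move/(_ [set v | F2_hom (gen2_l g h) (gen2_r g h) v = 1]); apply; split.
    exact: kernel_normal.
  move=> _ ->; apply/F2_hom_gen2_eq1.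
  by rewrite gmulfXn gmulfM gmulfV /= [F2_hom _ _ F2x]free_lift_gen
    [F2_hom _ _ F2y]free_lift_gen.
left; apply: F2_hom_gen2_free => w kw.
have : [set 1 : F2] w; last by [].
apply: kernel_sub_normal kw => //; first exact: trivial_normal.
by case=> [|m] // tm; case: tfree; exists m.+1.
Qed.
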